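(* Consider the stochastic Runge–Kutta methods described in the context, with $s$ stages in space and $r$ stages in time. When the symplecticity conditions $$b_mb_n-a_{mn}b_m-b_na_{nm}=0\qquad\forall\, m,n=1,\dots,s,$$ and $$\bar b_i\bar b_j-\bar a_{ji}\bar b_j-\bar b_i\bar a_{ij}=0,$$ $$\bar\beta_i\bar\beta_j-\bar\alpha_{ji}\bar\beta_j-\bar\beta_i\bar\alpha_{ij}=0,$$ $$\bar b_i\bar\beta_j-\bar\alpha_{ji}\bar b_j-\bar b_i\bar\alpha_{ij}=0,$$ $$\bar\beta_i\bar b_j-\bar a_{ji}\bar\beta_j-\bar\beta_i\bar a_{ij}=0,\qquad\forall\, i,j=1,\dots,r,$$ are satisfied, the Runge–Kutta methods are multisymplectic, and the following discrete multisymplectic form conservation law holds: $$\sum_{m=1}^s b_m\big[\omega_{1,m}-\omega_{0,m}\big]\triangle x+\sum_{i=1}^r\bar b_i\big[\kappa_{i,1}-\kappa_{i,0}\big]\triangle t+\sum_{i=1}^r\bar\beta_i\big[\widetilde\kappa_{i,1}-\widetilde\kappa_{i,0}\big]\triangle W=0,$$ where the discrete multisymplectic forms are defined by $$\omega_{i,m}:=\tfrac12\,\mathrm d z_{i,m}\wedge\mathbf M\,\mathrm d z_{i,m},\quad \kappa_{i,m}:=\tfrac12\,\mathrm d z_{i,m}\wedge\mathbf K\,\mathrm d z_{i,m},\quad \widetilde\kappa_{i,m}:=\tfrac12\,\mathrm d z_{i,m}\wedge\widetilde{\mathbf K}\,\mathrm d z_{i,m}.$$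
   Context: The method discretises the stochastic multisymplectic PDE in one space dimension $$\mathbf M\,dz+\mathbf K\,\partial_xz\,dt+\widetilde{\mathbf K}\,\partial_xz\circ dW_t=\nabla_zH(z)\,dt+\nabla_z\widetilde H(z)\circ dW_t,$$ where $z$ is vector-valued, $\mathbf M,\mathbf K,\widetilde{\mathbf K}$ are constant skew-symmetric matrices, $H,\widetilde H$ are functions of $z$, $W$ is a one-dimensional Brownian motion and $\circ\,dW_t$ is Stratonovich integration. The symbol $\mathrm d$ is the exterior derivative in the dependent variables. The domain is discretised by equidistant points with spacings $\triangle x$ and $\triangle t$. On a cell $[x_p,x_{p+1}]\times[t_k,t_{k+1}]$ the collocation points are $x_p+c_m\triangle x$ ($m=1,\dots,s$) and $t_k+d_i\triangle t$ ($i=1,\dots,r$), and $\triangle W=W(t_{k+1})-W(t_k)$. Notation for the values of $z=z(t,x)$: $$z_{0,m}:=z(t_k,x_p+c_m\triangle x),\quad z_{1,m}:=z(t_{k+1},x_p+c_m\triangle x),\quad z_{i,0}:=z(t_k+d_i\triangle t,x_p),\quad z_{i,1}:=z(t_k+d_i\triangle t,x_{p+1}),$$ $$Z_{i,m}:=z(t_k+d_i\triangle t,x_p+c_m\triangle x).$$ (Thus in $z_{0,m},z_{1,m}$, and likewise in $\omega_{0,m},\omega_{1,m}$, the first index marks the lower or upper time level; in $z_{i,0},z_{i,1}$, and likewise in $\kappa_{i,0},\kappa_{i,1},\widetilde\kappa_{i,0},\widetilde\kappa_{i,1}$, the second index marks the left or right edge of the cell.) The method is defined by $$Z_{i,m}=z_{i,0}+\triangle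 x\sum_{n=1}^sa_{mn}\,\delta_xZ_{i,n},\qquad z_{i,1}=z_{i,0}+\triangle x\sum_{n=1}^sb_n\,\delta_xZ_{i,n},$$ $$Z_{i,m}=z_{0,m}+\triangle t\sum_{j=1}^r\bar a_{ij}\,\delta_t^AZ_{j,m}+\triangle W\sum_{j=1}^r\bar\alpha_{ij}\,\delta_t^MZ_{j,m},$$ $$z_{1,m}=z_{0,m}+\triangle t\sum_{j=1}^r\bar b_j\,\delta_t^AZ_{j,m}+\triangle W\sum_{j=1}^r\bar\beta_j\,\delta_t^MZ_{j,m},$$ together with the defining relations $$\mathbf M\,\delta_t^AZ_{i,m}+\mathbf K\,\delta_xZ_{i,m}=\nabla_zH(Z_{i,m}),\qquad \mathbf M\,\delta_t^MZ_{i,m}+\widetilde{\mathbf K}\,\delta_xZ_{i,m}=\nabla_z\widetilde H(Z_{i,m}).$$ The coefficients satisfy the consistency conditions $d_i=\sum_{j}\bar a_{ij}$, $d_i=\sum_j\bar\alpha_{ij}$, $c_m=\sum_na_{mn}$ and $\sum_j\bar b_j=\sum_j\bar\beta_j=\sum_nb_n=1$. The discrete operators $\delta_x,\delta_t^A,\delta_t^M$ are discrete approximations to the spatial and temporal derivatives, taken to be the standard forward differences $$\delta_xZ_{i,n}=\frac{Z_{i,n+1}-Z_{i,n}}{\triangle x},\qquad \delta_t^AZ_{i,n}=\frac{Z_{i+1,n}-Z_{i,n}}{\triangle t},\qquad \delta_t^MZ_{i,n}=\frac{Z_{i+1,n}-Z_{i,n}}{\triangle W}.$$ *)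

(* Defs.v *)
From HB Require Import structures.
From mathcomp Require Import all_boot all_order all_algebra.
From mathcomp Require Import all_classical all_reals all_analysis.

Set Implicit Arguments.
Unset Strict Implicit.
Unset Printing Implicit Defensive.

Import Order.TTheory GRing.Theory Num.Theory.
Import numFieldNormedType.Exports.
Local Open Scope classical_set_scope.
Local Open Scope ring_scope.

Section Brownian.
Context (R : realType) (d : measure_display) (Omega : measurableType d).

(* The process is indexed by all of R, but only its restriction to nonnegative
   times is constrained. The second argument of [normal_prob] is the standard
   deviation. *)
Record brownian_motion (P : probability Omega R) (W : R -> {RV P >-> R}) :
    Prop := BrownianMotion {
  bm_start : {ae P, forall w, W 0 w = 0};
  bm_gauss : forall (t1 t2 : R) (A : set R),
    0 <= t1 -> t1 < t2 -> measurable A ->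
    P [set w | A (W t2 w - W t1 w)] = normal_prob 0 (Num.sqrt (t2 - t1)) A;
  bm_indep : forall (N : nat) (t : nat -> R) (A : nat -> set R),
    0 <= t 0%N -> (forall i, t i <= t i.+1) -> (forall i, measurable (A i)) ->
    P (\bigcap_(i < N) [set w | A i (W (t i.+1) w - W (t i) w)]) =
    (\prod_(i < N) P [set w | A i (W (t i.+1) w - W (t i) w)%R])%E;
  bm_cont : {ae P, forall w, {within `[0, +oo[, continuous (fun t => W t w)}}
}.

End Brownian.

Section Calculus.
Context (R : realType) (n : nat).

Definition dotv (x y : 'cV[R]_n) : R := (x^T *m y) 0 0.

Definition gradient (H : 'cV[R]_n -> R) (x : 'cV[R]_n) : 'cV[R]_n :=
  \col_i 'D_(delta_mx i 0) H x.

Definition class_C2 (H : 'cV[R]_n -> R) : Prop :=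
  [/\ forall x, differentiable H x,
      forall x, differentiable (gradient H) x &
      forall i j : 'I_n,
        continuous (fun x => 'D_(delta_mx j 0) (fun y => gradient H y i 0) x)].

Definition skew_symmetric (A : 'M[R]_n) : Prop := A^T = - A.

(* The dependent variables are functions on a normed space E parametrising a
   family of solutions, and their exterior derivatives are 1-forms on E: the
   vector-valued form dz at u is the Frechet derivative ['d z u]. For
   vector-valued 1-forms al and be at a point, al /\ be is the scalar 2-form
   sum_k al_k /\ be_k, where
   (al_k /\ be_k)(xi, eta) = al_k xi * be_k eta - al_k eta * be_k xi. *)
Definition wedge (E : Type) (al be : E -> 'cV[R]_n) (xi eta : E) : R :=
  dotv (al xi) (be eta) - dotv (al eta) (be xi).

Definition half_d_wedge_d (E : normedModType R) (A : 'M[R]_n)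
    (z : E -> 'cV[R]_n) (u : E) : E -> E -> R :=
  fun xi eta => 2^-1 * wedge ('d z u) (fun h => A *m 'd z u h) xi eta.

End Calculus.

(* Stages are numbered from 0, so that the nodes are [rk_c m] for m < s and
   [rk_d i] for i < r. The forward differences at the last stages also involve
   the nodes number s and r; these, [rk_c s] and [rk_d r], are left
   unconstrained, and further values of [rk_c] and [rk_d] are never used. *)
Record rk_coefficients (R : realType) (s r : nat) := RKCoefficients {
  rk_a : 'I_s -> 'I_s -> R;
  rk_b : 'I_s -> R;
  rk_c : nat -> R;
  rk_abar : 'I_r -> 'I_r -> R;
  rk_bbar : 'I_r -> R;
  rk_alphabar : 'I_r -> 'I_r -> R;
  rk_betabar : 'I_r -> R;
  rk_d : nat -> R
}.

Section Coefficients.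
Context (R : realType) (s r : nat) (T : rk_coefficients R s r).
Local Notation a := (rk_a T).
Local Notation b := (rk_b T).
Local Notation abar := (rk_abar T).
Local Notation bbar := (rk_bbar T).
Local Notation alphabar := (rk_alphabar T).
Local Notation betabar := (rk_betabar T).

Record rk_consistent : Prop := RKConsistent {
  cons_d_abar : forall i : 'I_r, rk_d T i = \sum_j abar i j;
  cons_d_alphabar : forall i : 'I_r, rk_d T i = \sum_j alphabar i j;
  cons_c : forall m : 'I_s, rk_c T m = \sum_n a m n;
  cons_bbar : \sum_j bbar j = 1;
  cons_betabar : \sum_j betabar j = 1;
  cons_b : \sum_n b n = 1
}.

Record rk_symplectic : Prop := RKSymplectic {
  symp_space : forall m n, b m * b n - a m n * b m - b n * a n m = 0;
  symp_bb : forall i j,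
    bbar i * bbar j - abar j i * bbar j - bbar i * abar i j = 0;
  symp_betabeta : forall i j,
    betabar i * betabar j - alphabar j i * betabar j
      - betabar i * alphabar i j = 0;
  symp_bbeta : forall i j,
    bbar i * betabar j - alphabar j i * bbar j - bbar i * alphabar i j = 0;
  symp_betab : forall i j,
    betabar i * bbar j - abar j i * betabar j - betabar i * abar i j = 0
}.

End Coefficients.

Record grid (R : realType) := Grid {
  grid_t0 : R;
  grid_x0 : R;
  grid_dt : R;
  grid_dx : R
}.

Definition grid_t (R : realType) (G : grid R) (k : nat) : R :=
  grid_t0 G + k%:R * grid_dt G.

Definition grid_x (R : realType) (G : grid R) (p : nat) : R :=
  grid_x0 G + p%:R * grid_dx G.

Section Method.
Context (R : realType) (n s r : nat) (T : rk_coefficients R s r).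
Context (G : grid R) (k p : nat).

Section Values.
Variable z : R -> R -> 'cV[R]_n.

(* z_{0,m} and z_{1,m} *)
Definition z_lower (m : nat) := z (grid_t G k) (grid_x G p + rk_c T m * grid_dx G).
Definition z_upper (m : nat) :=
  z (grid_t G k.+1) (grid_x G p + rk_c T m * grid_dx G).

(* z_{i,0} and z_{i,1} *)
Definition z_left (i : nat) := z (grid_t G k + rk_d T i * grid_dt G) (grid_x G p).
Definition z_right (i : nat) :=
  z (grid_t G k + rk_d T i * grid_dt G) (grid_x G p.+1).

(* Z_{i,m} *)
Definition z_stage (i m : nat) :=
  z (grid_t G k + rk_d T i * grid_dt G) (grid_x G p + rk_c T m * grid_dx G).

Definition delta_x (i m : nat) :=
  (grid_dx G)^-1 *: (z_stage i m.+1 - z_stage i m).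

Definition delta_tA (i m : nat) :=
  (grid_dt G)^-1 *: (z_stage i.+1 m - z_stage i m).

Definition delta_tM (dW : R) (i m : nat) :=
  dW^-1 *: (z_stage i.+1 m - z_stage i m).

End Values.

Record srk_solution (M K Kt : 'M[R]_n) (H Ht : 'cV[R]_n -> R) (dW : R)
    (z : R -> R -> 'cV[R]_n) : Prop := SRKSolution {
  srk_space_stage : forall (i : 'I_r) (m : 'I_s),
    z_stage z i m = z_left z i
      + grid_dx G *: \sum_(l < s) rk_a T m l *: delta_x z i l;
  srk_space_step : forall i : 'I_r,
    z_right z i = z_left z i
      + grid_dx G *: \sum_(l < s) rk_b T l *: delta_x z i l;
  srk_time_stage : forall (i : 'I_r) (m : 'I_s),
    z_stage z i m = z_lower z m
      + grid_dt G *: \sum_(j < r) rk_abar T i j *: delta_tA z j m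
      + dW *: \sum_(j < r) rk_alphabar T i j *: delta_tM z dW j m;
  srk_time_step : forall m : 'I_s,
    z_upper z m = z_lower z m
      + grid_dt G *: \sum_(j < r) rk_bbar T j *: delta_tA z j m
      + dW *: \sum_(j < r) rk_betabar T j *: delta_tM z dW j m;
  srk_drift : forall (i : 'I_r) (m : 'I_s),
    M *m delta_tA z i m + K *m delta_x z i m = gradient H (z_stage z i m);
  srk_diffusion : forall (i : 'I_r) (m : 'I_s),
    M *m delta_tM z dW i m + Kt *m delta_x z i m = gradient Ht (z_stage z i m)
}.

(* The two-forms below are attached to a family z of numerical solutions
   parametrised by E, and are evaluated at the parameter u. *)
Section Forms.
Context (E : normedModType R) (z : E -> R -> R -> 'cV[R]_n) (u : E).

Definition omega_lower (M : 'M[R]_n) (m : nat) :=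
  half_d_wedge_d M (fun v => z_lower (z v) m) u.
Definition omega_upper (M : 'M[R]_n) (m : nat) :=
  half_d_wedge_d M (fun v => z_upper (z v) m) u.
Definition kappa_left (K : 'M[R]_n) (i : nat) :=
  half_d_wedge_d K (fun v => z_left (z v) i) u.
Definition kappa_right (K : 'M[R]_n) (i : nat) :=
  half_d_wedge_d K (fun v => z_right (z v) i) u.

Definition discrete_multisymplectic_law (M K Kt : 'M[R]_n) (dW : R) : Prop :=
  forall xi eta : E,
    (\sum_(m < s) rk_b T m * (omega_upper M m xi eta - omega_lower M m xi eta))
      * grid_dx G
    + (\sum_(i < r) rk_bbar T i * (kappa_right K i xi eta - kappa_left K i xi eta))
      * grid_dt G
    + (\sum_(i < r) rk_betabar T i
        * (kappa_right Kt i xi eta - kappa_left Kt i xi eta)) * dW = 0.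

End Forms.
End Method.

(* Main.v *)
(* Differentiating the scheme in the parameter gives, for each direction, a
   field satisfying the same Runge-Kutta relations with the gradients replaced
   by the Hessians. For a bilinear form B, each one-dimensional symplecticity
   condition makes the increment of B over a step equal to the weighted sum of
   B(Z, dZ) + B(dZ, Z) over the stages. At each collocation point the spatial
   and temporal contributions cancel: M, K and Kt are skew-symmetric and the
   Hessians are symmetric (Schwarz). *)

Require Import Defs.
From HB Require Import structures.
From mathcomp Require Import all_boot all_order all_algebra.
From mathcomp Require Import all_classical all_reals all_analysis.
From mathcomp Require Import ring lra.

Set Implicit Arguments.
Unset Strict Implicit.
Unset Printing Implicit Defensive.

Import Order.TTheory GRing.Theory Num.Theory.
Import numFieldNormedType.Exports.
Local Open Scope classical_set_scope.
Local Open Scope ring_scope.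

(** * Symplectic Runge-Kutta methods and bilinear forms *)

Section BilinearRungeKutta.
Context (R : realFieldType) (V : lmodType R) (B : {biscalar V}) (r : nat).
Variables (w : 'I_r -> R) (c : 'I_r -> 'I_r -> R).

(** Both sides are expanded in [x0], [y0] and the increments. The terms with [x0] or [y0] agree, and
    the coefficients of [B (dX i) (dY j)] are [w i * w j] and [c j i * w j + w i * c i j], equal by
    symplecticity. Two trajectories are taken because a skew form vanishes on the diagonal. *)
Lemma symplectic_rk_bilinear_increment (x0 x1 y0 y1 : V)
    (X Y dX dY : 'I_r -> V) :
  (forall i j, w i * w j - c j i * w j - w i * c i j = 0) ->
  (forall i, X i = x0 + \sum_j c i j *: dX j) ->
  (forall i, Y i = y0 + \sum_j c i j *: dY j) ->
  x1 = x0 + \sum_j w j *: dX j ->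
  y1 = y0 + \sum_j w j *: dY j ->
  B x1 y1 - B x0 y0 = \sum_j w j * (B (X j) (dY j) + B (dX j) (Y j)).
Proof.
move=> wc hX hY -> ->.
have -> : \sum_j w j * (B (X j) (dY j) + B (dX j) (Y j)) =
    B x0 (\sum_j w j *: dY j) + B (\sum_j w j *: dX j) y0 +
    \sum_i \sum_j (c j i * w j + w i * c i j) * B (dX i) (dY j).
  transitivity (\sum_j w j * B x0 (dY j) + \sum_j w j * B (dX j) y0 +
      (\sum_j \sum_i c j i * w j * B (dX i) (dY j) +
       \sum_i \sum_j w i * c i j * B (dX i) (dY j))); last first.
    congr (_ + _ + _).
    - by rewrite linear_sumr; apply: eq_bigr => j _; rewrite linearZr_LR.
    - by rewrite linear_sumlz; apply: eq_bigr => j _; rewrite linearZl_LR.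
    - rewrite exchange_big -big_split; apply: eq_bigr => i _ /=.
      by rewrite -big_split; apply: eq_bigr => j _ /=; rewrite mulrDl.
  rewrite addrACA -!big_split; apply: eq_bigr => j _ /=.
  rewrite hX hY linearDl (linearDr B) linear_sumlz (linear_sumr B) !mulrDr.
  rewrite !mulr_sumr.
  rewrite -!addrA; congr (_ + (_ + (_ + _))).

    by apply: eq_bigr => i _; rewrite linearZl_LR /=; ring.
  by apply: eq_bigr => i _; rewrite linearZr_LR /=; ring.
rewrite linearDl !(linearDr B).
have -> : B (\sum_j w j *: dX j) (\sum_j w j *: dY j) =
    \sum_i \sum_j (c j i * w j + w i * c i j) * B (dX i) (dY j).
  rewrite linear_sumlz; apply: eq_bigr => i _.
  rewrite linear_sumr; apply: eq_bigr => j _.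
  have -> : c j i * w j + w i * c i j = w i * w j by have := wc i j; lra.
  by rewrite linearZl_LR linearZr_LR /= mulrA.
by ring.
Qed.

Lemma mul_biscalarD (h q : R) (x1 y1 x2 y2 : V) :
  h * (q * (B x1 y1 + B x2 y2)) = q * (B x1 (h *: y1) + B (h *: x2) y2).
Proof. by rewrite (linearZl_LR B) (linearZr_LR B) /=; ring. Qed.

End BilinearRungeKutta.

(** * Matrix bilinear forms and the two-forms they define *)

Section MatrixForms.
Context (R : realType) (n : nat).
Implicit Types (A : 'M[R]_n) (x y : 'cV[R]_n).

Definition mxform A x y : R := dotv x (A *m y).

Lemma mxform_is_bilinear A :
  bilinear_for (GRing.Scale.Law.clone _ _ *%R _)
    (GRing.Scale.Law.clone _ _ *%R _) (mxform A).
Proof.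
split=> [u|u] a x y; rewrite /mxform /dotv.
  by rewrite linearP mulmxDl -scalemxAl !mxE.
by rewrite mulmxDr -scalemxAr mulmxDr -scalemxAr !mxE.
Qed.

HB.instance Definition _ A := bilinear_isBilinear.Build _ _ _ _ _ _ (mxform A)
  (mxform_is_bilinear A).

Lemma dotvC x y : dotv x y = dotv y x.
Proof. by rewrite /dotv !mxE; apply: eq_bigr => i _; rewrite !mxE mulrC. Qed.

Lemma dotvDr x y1 y2 : dotv x (y1 + y2) = dotv x y1 + dotv x y2.
Proof. by rewrite /dotv mulmxDr mxE. Qed.

Lemma mxform_skew A x y : skew_symmetric A -> mxform A x y = - dotv (A *m x) y.
Proof.
move=> hA; rewrite /mxform /dotv trmx_mul hA mulmxN mulNmx mulmxA.
by rewrite [X in - X]mxE opprK.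
Qed.

(** For skew [A] the two terms of the wedge coincide, which cancels the factor 1/2. *)
Lemma half_d_wedge_dE (E : normedModType R) A (f : E -> 'cV[R]_n) u xi eta :
  skew_symmetric A ->
  half_d_wedge_d A f u xi eta = mxform A ('d f u xi) ('d f u eta).
Proof.
move=> hA; rewrite /half_d_wedge_d /wedge.
have -> : dotv ('d f u eta) (A *m 'd f u xi) =
    - mxform A ('d f u xi) ('d f u eta).
  by rewrite (mxform_skew _ _ hA) opprK dotvC.
by rewrite /mxform; field.
Qed.

(** Both sides of [dotv zx (F zy) = dotv (F zx) zy] are expanded by the two equations, and [L], [Q]
    are moved across by skewness. This is the cancellation at one collocation point, with [F] a
    Hessian. *)
Lemma mxform_symmetric_balance (L Q : 'M[R]_n) (F : 'cV[R]_n -> 'cV[R]_n)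
    (zx zy ax ay qx qy : 'cV[R]_n) :
  skew_symmetric L -> skew_symmetric Q ->
  (forall y1 y2, dotv y1 (F y2) = dotv (F y1) y2) ->
  L *m ax + Q *m qx = F zx -> L *m ay + Q *m qy = F zy ->
  mxform L zx ay + mxform L ax zy = - (mxform Q zx qy + mxform Q qx zy).
Proof.
move=> hL hQ hF ex ey.
have := hF zx zy; rewrite -ex -ey dotvDr -!/(mxform _ _ _).
rewrite (dotvC _ zy) dotvDr !(dotvC zy).
rewrite (mxform_skew ax _ hL) (mxform_skew qx _ hQ); lra.
Qed.

End MatrixForms.

(** * Symmetry of second directional derivatives *)

Section Schwarz.
Context (R : realType) (V : normedModType R).
Implicit Types (f : V -> R) (u v x : V).

(** Restriction to a line makes the one-variable mean value theorem applicable. *)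
Lemma is_derive_along f x v (t : R) :
  derivable f (x + t *: v) v ->
  is_derive t 1 (fun h => f (x + h *: v)) ('D_v f (x + t *: v)).
Proof.
have quotE : (fun h : R => h^-1 *: (((fun k => f (x + k *: v)) \o shift t) h%:A -
                                    f (x + t *: v))) =
             (fun h : R => h^-1 *: ((f \o shift (x + t *: v)) (h *: v) -
                                    f (x + t *: v))).
  apply/funext => h /=; congr (_ *: (f _ - _)).
  by rewrite [h%:A]mulr1 scalerDl addrCA.
by move=> df; apply: DeriveDef; rewrite /derivable /derive quotE.
Qed.

Lemma second_difference_mean_value f x u v (h : R) : 0 < h ->
  (forall y, derivable f y u) -> (forall y, derivable ('D_u f) y v) ->
  exists a b : R, [/\ 0 <= a <= h, 0 <= b <= h &
    f (x + h *: u + h *: v) - f (x + h *: u) - f (x + h *: v) + f x =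
    'D_v ('D_u f) (x + a *: u + b *: v) * h * h].
Proof.
move=> h0 fu fuv.
(* The second difference is [g h - g 0]. The mean value theorem in direction [u] turns it into an
   increment of ['D_u f] in direction [v], to which the theorem is applied again. *)
pose g (t : R) := f (x + h *: v + t *: u) - f (x + t *: u).
have dg (t : R) : is_derive t 1 g
    ('D_u f (x + h *: v + t *: u) - 'D_u f (x + t *: u)).
  by apply: is_deriveB; exact: is_derive_along.
have cont (l dl : R -> R) : (forall t : R, is_derive t 1 l (dl t)) ->
    {within `[0, h], continuous l}.
  move=> dlt; apply: continuous_subspaceT => t.
  by apply/differentiable_continuous/derivable1_diffP; have [] := dlt t.
have [a a0h ga] := MVT h0 (fun t _ => dg t) (cont _ _ dg).
pose k (t : R) := 'D_u f (x + a *: u + t *: v).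
have dk (t : R) : is_derive t 1 k ('D_v ('D_u f) (x + a *: u + t *: v)).
  exact: is_derive_along.
have [b b0h kb] := MVT h0 (fun t _ => dk t) (cont _ _ dk).
exists a, b; split.
- by move: a0h; rewrite in_itv /= => /andP[/ltW-> /ltW->].
- by move: b0h; rewrite in_itv /= => /andP[/ltW-> /ltW->].
have kh : 'D_u f (x + h *: v + a *: u) = k h by rewrite /k addrAC.
have k0 : 'D_u f (x + a *: u) = k 0 by rewrite /k scale0r addr0.
move: ga; rewrite kh k0 kb subr0 /g scale0r !addr0 => <-.
by rewrite (addrAC x (h *: v)); ring.
Qed.

(** The second difference is symmetric in [u] and [v], so its two mean value expressions give equal
    mixed derivatives at two points near [x]. Continuity at [x] then compares the values at [x]
    itself. *)
Lemma derive_comm f x u v :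
  (forall y, derivable f y u) -> (forall y, derivable f y v) ->
  (forall y, derivable ('D_u f) y v) -> (forall y, derivable ('D_v f) y u) ->
  {for x, continuous ('D_v ('D_u f))} -> {for x, continuous ('D_u ('D_v f))} ->
  'D_v ('D_u f) x = 'D_u ('D_v f) x.
Proof.
move=> fu fv fuv fvu cuv cvu; apply/eqP; rewrite -subr_eq0 -normr_le0.
apply/ler_addgt0Pl => e e0; rewrite addr0.
have e20 : 0 < e / 2 by rewrite divr_gt0.
have /cvgrPdist_le /(_ _ e20) /nbhs_ballP[r1 /= r10 hr1] := cvu.
have /cvgrPdist_le /(_ _ e20) /nbhs_ballP[r2 /= r20 hr2] := cuv.
(* This [h] keeps both intermediate points inside both balls; the [+ 1] keeps the denominator
   positive when [u] and [v] vanish. *)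
pose h := Num.min r1 r2 / (2 * (`|u| + `|v| + 1)).
have c0 : 0 < `|u| + `|v| + 1 by rewrite ltr_wpDl // addr_ge0.
have m0 : 0 < Num.min r1 r2 by rewrite lt_min r10 r20.
have h0 : 0 < h by rewrite divr_gt0 // mulr_gt0.
have hball (a b : R) : 0 <= a <= h -> 0 <= b <= h ->
    `|a *: u + b *: v| < Num.min r1 r2.
  move=> /andP[a0 ah] /andP[b0 bh].
  rewrite (le_lt_trans (ler_normD _ _)) // !normrZ !ger0_norm //.
  have -> : Num.min r1 r2 = h * (2 * (`|u| + `|v| + 1)).
    by rewrite /h divfK // lt0r_neq0 // mulr_gt0.
  have := ler_wpM2r (normr_ge0 u) ah; have := ler_wpM2r (normr_ge0 v) bh.
  have := mulr_gt0 h0 c0; set U := `|u|; set W := `|v|; nra.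
have [a [b [ab bb ha]]] := second_difference_mean_value x h0 fu fuv.
have [c [d [cb db hc]]] := second_difference_mean_value x h0 fv fvu.
have same : 'D_v ('D_u f) (x + a *: u + b *: v) =
            'D_u ('D_v f) (x + c *: v + d *: u).
  apply: (mulIf (lt0r_neq0 h0)); apply: (mulIf (lt0r_neq0 h0)).
  apply: etrans (esym ha) (etrans _ hc).
  have -> : x + h *: v + h *: u = x + h *: u + h *: v by rewrite addrAC.
  by congr (_ + _); rewrite addrAC.
have distE (y : V) : x - (x + y) = - y by rewrite opprD addNKr.
have near1 : `|'D_v ('D_u f) x - 'D_v ('D_u f) (x + a *: u + b *: v)| <= e / 2.
  apply: hr2; rewrite -ball_normE /ball_ /= -addrA distE normrN.
  by apply: lt_le_trans (hball _ _ ab bb) _; rewrite ge_min lexx orbT.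
have near2 : `|'D_u ('D_v f) x - 'D_u ('D_v f) (x + c *: v + d *: u)| <= e / 2.
  apply: hr1; rewrite -ball_normE /ball_ /= -addrA distE normrN addrC.
  by apply: lt_le_trans (hball _ _ db cb) _; rewrite ge_min lexx.
rewrite -same in near2.
rewrite -(subrKA ('D_v ('D_u f) (x + a *: u + b *: v))) [leRHS]splitr.
by apply: le_trans (ler_normD _ _) (lerD near1 _); rewrite distrC.
Qed.

End Schwarz.

(** * Self-adjointness of the Hessian *)

Section Hessian.
Context (R : realType) (n : nat) (H : 'cV[R]_n -> R) (hH : class_C2 H).

(** Translates the Frechet derivative of the gradient into the iterated directional derivatives of
    [derive_comm]. *)
Lemma gradient_coord (x : 'cV[R]_n) i v :
  ('d (gradient H) x v) i 0 = 'D_v ('D_(delta_mx i 0) H) x.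
Proof.
have [_ dG _] := hH.
rewrite -deriveE // derive_mx; last exact: diff_derivable.
by rewrite mxE; congr ('D_v _ x); apply/funext => y; rewrite mxE.
Qed.

Lemma hessian_entry_sym (x : 'cV[R]_n) i j :
  ('d (gradient H) x (delta_mx j 0)) i 0 =
  ('d (gradient H) x (delta_mx i 0)) j 0.
Proof.
have [dH dG cH] := hH; rewrite !gradient_coord.
have gradE l : (fun y => gradient H y l 0) = 'D_(delta_mx l 0) H.
  by apply/funext => y; rewrite mxE.
have dgrad l y v : derivable ('D_(delta_mx l 0) H) y v.
  by rewrite -gradE; apply: ((derivable_mxP _ _ _).1 (diff_derivable (dG y))).
apply: derive_comm => [y|y|y|y||]; try exact: diff_derivable; try exact: dgrad.
  by move: (cH i j x); rewrite gradE.
by move: (cH j i x); rewrite gradE.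
Qed.

Lemma hessian_sym (x y1 y2 : 'cV[R]_n) :
  dotv y1 ('d (gradient H) x y2) = dotv ('d (gradient H) x y1) y2.
Proof.
have expand (a b : 'cV[R]_n) : dotv a ('d (gradient H) x b) =
    \sum_i \sum_j a i 0 * b j 0 * ('d (gradient H) x (delta_mx j 0)) i 0.
  rewrite /dotv !mxE; apply: eq_bigr => i _; rewrite mxE.
  rewrite [b in LHS](matrix_sum_delta b) linear_sum /= summxE mulr_sumr.
  apply: eq_bigr => j _.
  by rewrite big_ord1 linearZ /= mxE mulrA.
rewrite expand [RHS]dotvC expand exchange_big; apply: eq_bigr => i _ /=.
by apply: eq_bigr => j _; rewrite hessian_entry_sym (mulrC (y1 _ _)).
Qed.

End Hessian.

(** * Differentiation rules for the terms of the scheme *)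

Lemma is_derive_mulmx (R : realType) (V : normedModType R) (m n q : nat)
    (A : 'M[R]_(m, n)) (f : V -> 'M[R]_(n, q)) (u h : V) (df : 'M[R]_(n, q)) :
  is_derive u h f df -> is_derive u h (fun v => A *m f v) (A *m df).
Proof.
move=> [fu <-]; have fuij := (derivable_mxP _ _ _).1 fu.
have isd i j : is_derive u h (fun v => (A *m f v) i j) ((A *m 'D_h f u) i j).
  have -> : (fun v => (A *m f v) i j) = \sum_l (A i l \*: (fun v => f v l j)).
    by apply/funext => v; rewrite mxE fct_sumE.
  rewrite mxE derive_mx //; apply: is_derive_sum => l; rewrite mxE.
  exact/is_deriveZ/derivableP.
have dA : derivable (fun v => A *m f v) u h by apply/derivable_mxP => i j.
apply: DeriveDef => //; rewrite derive_mx //.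
by apply/matrixP => i j; rewrite mxE; exact: derive_val.
Qed.

(** The right-hand sides of the spatial relations have this shape; those of the temporal relations
    have it nested twice, once for the drift and once for the diffusion. *)
Lemma is_derive_add_lincomb (R : realType) (V W : normedModType R) (N : nat)
    (f : V -> W) (F : 'I_N -> V -> W) (q : 'I_N -> R) (c : R) (u h : V)
    (df : W) (dF : 'I_N -> W) :
  is_derive u h f df -> (forall l, is_derive u h (F l) (dF l)) ->
  is_derive u h (fun v => f v + c *: \sum_l q l *: F l v)
    (df + c *: \sum_l q l *: dF l).
Proof.
move=> hf hF.
have -> : (fun v => f v + c *: \sum_l q l *: F l v) =
    f + c \*: (\sum_l q l \*: F l).
  by apply/funext => v /=; rewrite fctE /= fct_sumE.
by apply: is_deriveD; apply: is_deriveZ; apply: is_derive_sum => l;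
  exact: is_deriveZ.
Qed.

(* The variation field (t, x) |-> d z(t, x) (h): evaluating the difference
   operators on it gives their exterior derivatives in the direction h. *)
Definition variation (R : realType) (n : nat) (E : normedModType R)
    (z : E -> R -> R -> 'cV[R]_n) (u h : E) : R -> R -> 'cV[R]_n :=
  fun t x => 'd (fun v => z v t x) u h.

(** * The scheme linearised along a family of solutions *)

Section VariationalEquations.
Context (R : realType) (n s r : nat) (T : rk_coefficients R s r).
Context (G : grid R) (k p : nat) (M K Kt : 'M[R]_n) (H Ht : 'cV[R]_n -> R).
Context (dW : R).

(** [S i m] and [St i m] stand for the Hessians of [H] and [Ht] at the stage value, hence the
    dependence on the collocation point. *)
Record srk_variation (S St : 'I_r -> 'I_s -> 'cV[R]_n -> 'cV[R]_n)
    (y : R -> R -> 'cV[R]_n) : Prop := SRKVariation {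
  var_space_stage : forall (i : 'I_r) (m : 'I_s),
    z_stage T G k p y i m = z_left T G k p y i
      + grid_dx G *: \sum_(l < s) rk_a T m l *: delta_x T G k p y i l;
  var_space_step : forall i : 'I_r,
    z_right T G k p y i = z_left T G k p y i
      + grid_dx G *: \sum_(l < s) rk_b T l *: delta_x T G k p y i l;
  var_time_stage : forall (i : 'I_r) (m : 'I_s),
    z_stage T G k p y i m = z_lower T G k p y m
      + grid_dt G *: \sum_(j < r) rk_abar T i j *: delta_tA T G k p y j m
      + dW *: \sum_(j < r) rk_alphabar T i j *: delta_tM T G k p y dW j m;
  var_time_step : forall m : 'I_s,
    z_upper T G k p y m = z_lower T G k p y m
      + grid_dt G *: \sum_(j < r) rk_bbar T j *: delta_tA T G k p y j m
      + dW *: \sum_(j < r) rk_betabar T j *: delta_tM T G k p y dW j m;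
  var_drift : forall (i : 'I_r) (m : 'I_s),
    M *m delta_tA T G k p y i m + K *m delta_x T G k p y i m =
    S i m (z_stage T G k p y i m);
  var_diffusion : forall (i : 'I_r) (m : 'I_s),
    M *m delta_tM T G k p y dW i m + Kt *m delta_x T G k p y i m =
    St i m (z_stage T G k p y i m)
}.

Lemma srk_solution_variation (E : normedModType R) (U : set E)
    (z : E -> R -> R -> 'cV[R]_n) (u h : E) :
  class_C2 H -> class_C2 Ht -> open U -> U u ->
  (forall t x, differentiable (fun v => z v t x) u) ->
  (forall v, U v -> srk_solution T G k p M K Kt H Ht dW (z v)) ->
  srk_variation
    (fun i m => 'd (gradient H) (z_stage T G k p (z u) i m))
    (fun i m => 'd (gradient Ht) (z_stage T G k p (z u) i m))
    (variation z u h).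
Proof.
move=> hH hHt hU Uu dz hsol.
have isd t x : is_derive u h (fun v => z v t x) (variation z u h t x).
  apply: DeriveDef; first exact/diff_derivable/dz.
  by rewrite deriveE //; exact: dz.
(* The relations hold on the open set [U] around [u], so their two sides have the same derivative at
   [u]. *)
have unique (f g : E -> 'cV[R]_n) df dg : (forall v, U v -> f v = g v) ->
    is_derive u h f df -> is_derive u h g dg -> df = dg.
  move=> fg /@derive_val <- /@derive_val <-; apply: near_eq_derive.
  by near=> v; apply: fg; near: v; exact: open_nbhs_nbhs.
(* Covers [delta_x], [delta_tA] and [delta_tM] at once: each is a difference of two values times a
   factor independent of the parameter. *)
have isdq (c : R) t1 x1 t2 x2 :
    is_derive u h (fun v => c *: (z v t1 x1 - z v t2 x2))
      (c *: (variation z u h t1 x1 - variation z u h t2 x2)).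
  by apply: is_deriveZ; exact: is_deriveB.
have isdgrad F i m : class_C2 F ->
    is_derive u h (fun v => gradient F (z_stage T G k p (z v) i m))
      ('d (gradient F) (z_stage T G k p (z u) i m)
        (z_stage T G k p (variation z u h) i m)).
  move=> [_ dF _].
  have dZ := dz (grid_t G k + rk_d T i * grid_dt G)
    (grid_x G p + rk_c T m * grid_dx G).
  apply: DeriveDef.
    exact/diff_derivable/(differentiable_comp dZ (dF _)).
  rewrite deriveE; last exact: (differentiable_comp dZ (dF _)).
  by rewrite (diff_comp dZ (dF _)).
split.
- move=> i m; apply: unique (fun v Uv => srk_space_stage (hsol v Uv) i m)
    (isd _ _) _.
  exact: (is_derive_add_lincomb _ _ (isd _ _) (fun l => isdq _ _ _ _ _)).
- move=> i; apply: unique (fun v Uv => srk_space_step (hsol v Uv) i)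
    (isd _ _) _.
  exact: (is_derive_add_lincomb _ _ (isd _ _) (fun l => isdq _ _ _ _ _)).
- move=> i m; apply: unique (fun v Uv => srk_time_stage (hsol v Uv) i m)
    (isd _ _) _.
  exact: (is_derive_add_lincomb _ _ (is_derive_add_lincomb _ _ (isd _ _)
    (fun l => isdq _ _ _ _ _)) (fun l => isdq _ _ _ _ _)).
- move=> m; apply: unique (fun v Uv => srk_time_step (hsol v Uv) m) (isd _ _) _.
  exact: (is_derive_add_lincomb _ _ (is_derive_add_lincomb _ _ (isd _ _)
    (fun l => isdq _ _ _ _ _)) (fun l => isdq _ _ _ _ _)).
- move=> i m; apply: unique (fun v Uv => srk_drift (hsol v Uv) i m) _
    (isdgrad _ _ _ _) => //.
  by apply: is_deriveD; apply: is_derive_mulmx; exact: isdq.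
- move=> i m; apply: unique (fun v Uv => srk_diffusion (hsol v Uv) i m) _
    (isdgrad _ _ _ _) => //.
  by apply: is_deriveD; apply: is_derive_mulmx; exact: isdq.
Unshelve. all: by end_near. Qed.

End VariationalEquations.

(** * Conservation for pairs of solutions of the linearised scheme *)

Section Conservation.
Context (R : realType) (n s r : nat) (T : rk_coefficients R s r).
Context (hsymp : rk_symplectic T) (G : grid R) (hdt : grid_dt G != 0).
Context (k p : nat) (M K Kt : 'M[R]_n) (dW : R).
Context (hM : skew_symmetric M) (hK : skew_symmetric K).
Context (hKt : skew_symmetric Kt).
Context (S St : 'I_r -> 'I_s -> 'cV[R]_n -> 'cV[R]_n).
Context (hS : forall i m y1 y2, dotv y1 (S i m y2) = dotv (S i m y1) y2).
Context (hSt : forall i m y1 y2, dotv y1 (St i m y2) = dotv (St i m y1) y2).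
Context (x y : R -> R -> 'cV[R]_n).
Context (hx : srk_variation T G k p M K Kt dW S St x).
Context (hy : srk_variation T G k p M K Kt dW S St y).

Local Notation Zx := (z_stage T G k p x).
Local Notation Zy := (z_stage T G k p y).
Local Notation Xx := (delta_x T G k p x).
Local Notation Xy := (delta_x T G k p y).
Local Notation Ax := (delta_tA T G k p x).
Local Notation Ay := (delta_tA T G k p y).
Local Notation Bx := (delta_tM T G k p x dW).
Local Notation By := (delta_tM T G k p y dW).

(** The spatial relations form a symplectic Runge-Kutta step with increments [grid_dx G *: delta_x].
    The matrix stays general, to serve for both [K] and [Kt]. *)
Lemma space_increment (A : 'M[R]_n) (i : 'I_r) :
  mxform A (z_right T G k p x i) (z_right T G k p y i)
    - mxform A (z_left T G k p x i) (z_left T G k p y i) =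
  grid_dx G * \sum_(m < s) rk_b T m
    * (mxform A (Zx i m) (Xy i m) + mxform A (Xx i m) (Zy i m)).
Proof.
rewrite (@symplectic_rk_bilinear_increment _ _ (mxform A) s (rk_b T) (rk_a T)
  (z_left T G k p x i) _ (z_left T G k p y i) _ (Zx i) (Zy i)
  (fun m => grid_dx G *: Xx i m) (fun m => grid_dx G *: Xy i m)).
- rewrite mulr_sumr; apply: eq_bigr => m _.
  by rewrite (mul_biscalarD (mxform A)).
- by move=> l m; have := symp_space hsymp l m; lra.
- move=> m; rewrite (var_space_stage hx) scaler_sumr; congr (_ + _).
  by apply: eq_bigr => l _; rewrite scalerA mulrC -scalerA.
- move=> m; rewrite (var_space_stage hy) scaler_sumr; congr (_ + _).
  by apply: eq_bigr => l _; rewrite scalerA mulrC -scalerA.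
- rewrite (var_space_step hx) scaler_sumr; congr (_ + _).
  by apply: eq_bigr => l _; rewrite scalerA mulrC -scalerA.
- rewrite (var_space_step hy) scaler_sumr; congr (_ + _).
  by apply: eq_bigr => l _; rewrite scalerA mulrC -scalerA.
Qed.

(* For dW <> 0 both temporal increments [dt A_j] and [dW B_j] equal
   Z_{j+1} - Z_j, so only the sum of the four temporal symplecticity
   conditions matters: it is the condition for the weights bbar + betabar
   and the matrix abar + alphabar. For dW = 0 the diffusion terms vanish. *)
Lemma time_increment (m : 'I_s) :
  mxform M (z_upper T G k p x m) (z_upper T G k p y m)
    - mxform M (z_lower T G k p x m) (z_lower T G k p y m) =
  grid_dt G * (\sum_(j < r) rk_bbar T j
    * (mxform M (Zx j m) (Ay j m) + mxform M (Ax j m) (Zy j m)))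
  + dW * \sum_(j < r) rk_betabar T j
    * (mxform M (Zx j m) (By j m) + mxform M (Bx j m) (Zy j m)).
Proof.
(* [e] equals [dW * dW^-1], as the inverse of zero is zero by convention; it treats both cases in
   one computation. *)
pose e : R := (dW != 0)%:R.
have ee : e * e = e by rewrite /e; case: (_ != _); rewrite ?mulr1 ?mulr0.
have dtA (z : R -> R -> 'cV[R]_n) j : grid_dt G *: delta_tA T G k p z j m =
    z_stage T G k p z j.+1 m - z_stage T G k p z j m.
  by rewrite scalerA divff // scale1r.
have dWB (z : R -> R -> 'cV[R]_n) j : dW *: delta_tM T G k p z dW j m =
    e *: (z_stage T G k p z j.+1 m - z_stage T G k p z j m).
  rewrite scalerA /e; have [->|dW0] := eqVneq dW 0; first by rewrite mul0r.
  by rewrite divff.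
pose D (z : R -> R -> 'cV[R]_n) (j : 'I_r) :=
  z_stage T G k p z j.+1 m - z_stage T G k p z j m.
(* The drift and diffusion sums merge into those of a single method with increments [D z j]. *)
have sumD (z : R -> R -> 'cV[R]_n) (q q' : 'I_r -> R) :
    grid_dt G *: (\sum_(j < r) q j *: delta_tA T G k p z j m)
    + dW *: (\sum_(j < r) q' j *: delta_tM T G k p z dW j m) =
    \sum_j (q j + e * q' j) *: D z j.
  rewrite !scaler_sumr -big_split; apply: eq_bigr => j _ /=.
  have swap (h1 h2 : R) (v : 'cV[R]_n) : h1 *: (h2 *: v) = h2 *: (h1 *: v).
    by rewrite !scalerA mulrC.
  by rewrite swap dtA (swap dW) dWB swap (scalerDl (D z j)) scalerA.
rewrite (@symplectic_rk_bilinear_increment _ _ (mxform M) r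
  (fun j => rk_bbar T j + e * rk_betabar T j)
  (fun i j => rk_abar T i j + e * rk_alphabar T i j)
  (z_lower T G k p x m) _ (z_lower T G k p y m) _ (Zx^~ m) (Zy^~ m)
  (D x) (D y)).
- rewrite !mulr_sumr -big_split; apply: eq_bigr => j _ /=.
  rewrite !(mul_biscalarD (mxform M)).
  rewrite !dtA !dWB -/(D x j) -/(D y j).
  by rewrite linearZl_LR linearZr_LR /=; ring.
- move=> i j.
  have := symp_bb hsymp i j; have := symp_betabeta hsymp i j.
  have := symp_bbeta hsymp i j; have := symp_betab hsymp i j.
  move: (rk_bbar T) (rk_betabar T) (rk_abar T) (rk_alphabar T).
  move=> b be a al h1 h2 h3 h4.
  (* Expansion in powers of [e]: the two mixed conditions together give the coefficient of [e], and
     the two pure ones give the others. *)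
  transitivity ((b i * b j - a j i * b j - b i * a i j)
    + e * (be i * b j - a j i * be j - be i * a i j)
    + e * (b i * be j - al j i * b j - b i * al i j)
    + e * e * (be i * be j - al j i * be j - be i * al i j)); first by ring.
  by rewrite h1 h2 h3 h4 !mulr0 !addr0.
- by move=> i; rewrite (var_time_stage hx) -addrA sumD.
- by move=> i; rewrite (var_time_stage hy) -addrA sumD.
- by rewrite (var_time_step hx) -addrA sumD.
- by rewrite (var_time_step hy) -addrA sumD.
Qed.

(** The increment lemmas turn all three terms into double sums over the collocation points, where
    every summand vanishes by [mxform_symmetric_balance]. *)
Lemma srk_variation_conservation :
  (\sum_(m < s) rk_b T m *
    (mxform M (z_upper T G k p x m) (z_upper T G k p y m)
     - mxform M (z_lower T G k p x m) (z_lower T G k p y m))) * grid_dx G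
  + (\sum_(i < r) rk_bbar T i *
    (mxform K (z_right T G k p x i) (z_right T G k p y i)
     - mxform K (z_left T G k p x i) (z_left T G k p y i))) * grid_dt G
  + (\sum_(i < r) rk_betabar T i *
    (mxform Kt (z_right T G k p x i) (z_right T G k p y i)
     - mxform Kt (z_left T G k p x i) (z_left T G k p y i))) * dW = 0.
Proof.
pose c (i : 'I_r) (m : 'I_s) :=
  mxform K (Zx i m) (Xy i m) + mxform K (Xx i m) (Zy i m).
pose ct (i : 'I_r) (m : 'I_s) :=
  mxform Kt (Zx i m) (Xy i m) + mxform Kt (Xx i m) (Zy i m).
(* The spatial terms are summed with [m] outermost, to match the temporal term. *)
have space (A : 'M[R]_n) (q : 'I_r -> R) (f : 'I_r -> 'I_s -> R) (h : R) :
    (forall i m, f i m =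
       mxform A (Zx i m) (Xy i m) + mxform A (Xx i m) (Zy i m)) ->
    (\sum_(i < r) q i *
      (mxform A (z_right T G k p x i) (z_right T G k p y i)
       - mxform A (z_left T G k p x i) (z_left T G k p y i))) * h =
    \sum_(m < s) \sum_(i < r) grid_dx G * rk_b T m * (h * q i * f i m).
  move=> hf; rewrite exchange_big mulr_suml; apply: eq_bigr => i _ /=.
  rewrite space_increment !mulr_sumr mulr_suml; apply: eq_bigr => m _.
  by rewrite hf; ring.
rewrite (space K _ c) // (space Kt _ ct) // mulr_suml -!big_split big1 //.
move=> m _ /=.
rewrite time_increment mulrDr mulrDl -addrA addrACA.
rewrite !mulr_sumr !mulr_suml -!big_split big1 // => j _ /=.
(* The cancellation is separate for each weight: [rk_bbar] pairs [M] with [K], and [rk_betabar]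
   pairs [M] with [Kt]. *)
have ed := mxform_symmetric_balance hM hK (hS j m) (var_drift hx j m)
  (var_drift hy j m).
have es := mxform_symmetric_balance hM hKt (hSt j m) (var_diffusion hx j m)
  (var_diffusion hy j m).
by rewrite ed es /c /ct; ring.
Qed.

End Conservation.

Theorem theorem3p1 (R : realType) (dO : measure_display)
    (Omega : measurableType dO) (P : probability Omega R)
    (W : R -> {RV P >-> R}) (hW : brownian_motion W)
    (n : nat) (M K Kt : 'M[R]_n)
    (hM : skew_symmetric M) (hK : skew_symmetric K) (hKt : skew_symmetric Kt)
    (H Ht : 'cV[R]_n -> R) (hH : class_C2 H) (hHt : class_C2 Ht)
    (s r : nat) (T : rk_coefficients R s r)
    (hcons : rk_consistent T) (hsymp : rk_symplectic T)
    (G : grid R) (ht0 : 0 <= grid_t0 G) (hdt : 0 < grid_dt G)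
    (hdx : 0 < grid_dx G) (k p : nat)
    (E : normedModType R) (U : set E) (hU : open U)
    (z : Omega -> E -> R -> R -> 'cV[R]_n)
    (hdiff : {ae P, forall w, forall u t x, U u ->
       differentiable (fun v => z w v t x) u})
    (hsol : {ae P, forall w, forall u, U u ->
       srk_solution T G k p M K Kt H Ht
         (W (grid_t G k.+1) w - W (grid_t G k) w) (z w u)}) :
  {ae P, forall w, forall u, U u ->
     discrete_multisymplectic_law T G k p (z w) u M K Kt
       (W (grid_t G k.+1) w - W (grid_t G k) w)}.
Proof.
(* The argument is pathwise: once [w] is fixed, the Brownian increment is a real constant. *)
apply: filterS2 hdiff hsol => w dz sol u Uu xi eta.
have var h := srk_solution_variation h hH hHt hU Uu
  (fun t x => dz u t x Uu) sol.
rewrite /omega_upper /omega_lower /kappa_left /kappa_right.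
under eq_bigr do rewrite !(half_d_wedge_dE _ _ _ _ hM).
under [X in _ + X * _ + _]eq_bigr do rewrite !(half_d_wedge_dE _ _ _ _ hK).
under [X in _ + X * _]eq_bigr do rewrite !(half_d_wedge_dE _ _ _ _ hKt).
(* The differentials in directions [xi] and [eta] are by definition grid values of the two variation
   fields. *)
by apply: (srk_variation_conservation hsymp (lt0r_neq0 hdt) hM hK hKt _ _
  (var xi) (var eta)) => i m y1 y2; exact: hessian_sym.
Qed.
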